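(* Let $\mathcal{P}_{\mathrm{b}}$ be the set of all values $\Pr(\phi)$, where $\phi:A\times B\to C$ ranges over all bilinear maps between finite abelian groups $A,B,C$. Then all limit points of $\mathcal{P}_{\mathrm{b}}$ (in $\mathbf{R}$) are rational, and $\mathcal{P}_{\mathrm{b}}$ is well ordered by $>$.
   Context: For finite abelian groups $A,B,C$ and a bilinear (i.e. biadditive) map $\phi:A\times B\to C$, $\Pr(\phi)=\frac{1}{|A||B|}|\{(a,b)\in A\times B:\phi(a,b)=0\}|$. A set of real numbers is well ordered by $>$ if each of its nonempty subsets has a greatest element (equivalently, it contains no infinite strictly increasing sequence). *)

(* Defs.v *)
From HB Require Import structures.
From mathcomp Require Import all_boot all_order all_algebra.
From mathcomp Require Import all_classical all_reals all_analysis.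

Set Implicit Arguments.
Unset Strict Implicit.
Unset Printing Implicit Defensive.

Import Order.TTheory GRing.Theory Num.Theory.
Import numFieldNormedType.Exports.

Local Open Scope classical_set_scope.
Local Open Scope ring_scope.

(* MathComp's [bilinear_for] is for modules over a common ring; for abelian
   groups bilinearity is additivity in each variable. *)
Definition biadditive (A B C : zmodType) (phi : A -> B -> C) : Prop :=
  (forall b, {morph phi^~ b : x y / x + y}) /\
  (forall a, {morph phi a : x y / x + y}).

Definition zero_prob (R : realType) (A B C : finZmodType)
    (phi : A -> B -> C) : R :=
  #|[set ab : A * B | phi ab.1 ab.2 == 0]%SET|%:R / (#|A|%:R * #|B|%:R).

Definition bilinear_probs (R : realType) : set R :=
  [set p | exists (A B C : finZmodType) (phi : A -> B -> C),
             biadditive phi /\ p = zero_prob R phi].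

Definition well_ordered_by_gt (R : realType) (P : set R) : Prop :=
  forall S : set R, S `<=` P -> S !=set0 ->
    exists2 m, S m & forall x, S x -> x <= m.

(* Main.v *)
(** Let F be an ultrafilter on an index set of bilinear maps.  It suffices to
    show that along F the probabilities tend to a rational q and are eventually
    at least q: the closure of the set of probabilities then consists of
    rationals, and the supremum of any set of probabilities is at most one of
    its members.  This property of a family of reals passes to sums and to
    products of nonnegative families, is unchanged by adding a nonnegative
    error tending to 0, and holds for 1/m with m a family of naturals.

    The probability on G x H is the average over a in G of 1/|phi(a, H)|.  If
    it does not tend to 0, the elements a with |phi(a, H)| <= N form, for N
    large and fixed and F-almost everywhere, a subgroup K outside of which the
    sizes |phi(a, H)| tend to infinity; hence one may replace G by K at the
    cost of a factor 1/|G : K| and a nonnegative error tending to 0.  The same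
    applies to H.  Once all the |phi(a, H)| and |phi(G, b)| are bounded, so is
    the group D generated by phi(G, H), and averaging over the characters of D
    writes the probability as |D|^-1 times a sum of |D| unit fractions. *)

Require Import Defs.
From HB Require Import structures.
From mathcomp Require Import all_boot all_order all_algebra.
From mathcomp Require Import all_fingroup all_character.
From mathcomp Require Import all_classical all_reals all_analysis.

Set Implicit Arguments.
Unset Strict Implicit.
Unset Printing Implicit Defensive.

Import Order.TTheory GRing.Theory Num.Theory.
Import numFieldNormedType.Exports.

Section FiniteGroups.
Local Open Scope group_scope.
Import mathcomp.boot.fintype mathcomp.boot.finset.

(** * Packing numbers of a filtered group *)

Section Filtration.
Variables (gT : finGroupType) (G : {group gT}) (X : nat -> {set gT}).
Hypothesis XG : forall N, X N \subset G.
Hypothesis X1 : forall N, 0 < N -> 1 \in X N.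
Hypothesis XV : forall N x, x \in X N -> x^-1 \in X N.
Hypothesis Xle : forall M N, M <= N -> X M \subset X N.
Hypothesis XM : forall M N x y, x \in X M -> y \in X N -> x * y \in X (M * N)%N.

(** [X N] acts as the ball of radius [N] about 1, radii multiplying under products; a separated set
    is a packing at scale [N]. *)
Definition separated N (S : {set gT}) :=
  (S \subset G) && [forall s in S, forall t in S, (s^-1 * t \in X N) ==> (s == t)].

Definition sepnum N := \max_(S : {set gT} | separated N S) #|S|.

Lemma separatedP N (S : {set gT}) :
  reflect (S \subset G /\
           {in S &, forall s t, s^-1 * t \in X N -> s = t}) (separated N S).
Proof.
apply: (iffP andP) => -[SG sepS]; split=> //.
  move=> s t sS tS st; apply/eqP; move/forall_inP: sepS => /(_ s sS).
  by move/forall_inP/(_ t tS)/implyP; apply.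
apply/forall_inP => s sS; apply/forall_inP => t tS.
by apply/implyP => /(sepS s t sS tS) ->.
Qed.

Lemma sepnum_witness N : exists2 S, separated N S & sepnum N = #|S|.
Proof.
have sep0 : separated N set0.
  by apply/separatedP; split=> [|s t]; rewrite ?sub0set ?inE.
rewrite /sepnum (bigop.bigmax_eq_arg set0) //.
by case: arg_maxnP => // S sepS _; exists S.
Qed.

Lemma sepnum_gt0 N : 0 < sepnum N.
Proof.
apply: leq_trans (leq_bigmax_cond [set 1] _); first by rewrite cards1.
apply/separatedP; split=> [|s t /set1P -> /set1P -> //].
by rewrite sub1set group1.
Qed.

Lemma sepnum_le M N : M <= N -> sepnum N <= sepnum M.
Proof.
move=> leMN; have [S /separatedP[SG sepS] ->] := sepnum_witness N.
apply: leq_bigmax_cond; apply/separatedP; split=> // s t sS tS st.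
by apply: sepS => //; apply: (subsetP (Xle leMN)).
Qed.

(** The translates of [X N] by the members of a packing at scale [N * N] are disjoint. *)
Lemma sepnum_card N : sepnum (N * N) * #|X N| <= #|G|.
Proof.
have [S /separatedP[SG sepS] ->] := sepnum_witness (N * N).
rewrite -cardsX.
have inj : {in setX S (X N) &, injective (fun p => p.1 * p.2)}.
  move=> [s x] [t y] /= /setXP[/= sS xX] /setXP[/= tS yX] /= e.
  have st : s = t.
    apply: sepS => //; have -> : s^-1 * t = x * y^-1.
      by rewrite -[x](mulKg s) e -!mulgA mulgV mulg1.
    by apply: XM => //; apply: XV.
  by rewrite st in e *; rewrite (mulgI _ _ _ e).
rewrite -(card_in_imset inj) subset_leq_card //.
apply/subsetP=> _ /imsetP[[s x] /setXP[/= sS xX] ->] /=.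
by apply: groupM; [apply: (subsetP SG) | apply: (subsetP (XG N))].
Qed.

(* If the packing number does not drop from scale N to scale M * N, then a
   maximal packing at scale M * N is still maximal at scale N, so its balls of
   radius N cover G; an element of X M can only lie in the central one. *)
Lemma sepnum_stable M N :
  0 < N -> N <= M -> sepnum N = sepnum (M * N) -> X M = X N.
Proof.
move=> N0 leNM e; apply/eqP; rewrite eqEsubset (Xle leNM) andbT.
have M0 : 0 < M by apply: leq_trans leNM.
have [S sepMN cardS] := sepnum_witness (M * N).
have [SG sepS] := separatedP _ _ sepMN.
have [s0 s0S] : exists s, s \in S.
  by apply/set0Pn; rewrite -card_gt0 -cardS sepnum_gt0.
apply/subsetP => x xX.
have leM : M <= M * N by rewrite leq_pmulr.
have leN : N <= M * N by rewrite leq_pmull.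
have [xS|xS] := boolP (s0 * x \in S).
  have s0x : s0 = s0 * x by apply: sepS => //; rewrite mulKg (subsetP (Xle leM)).
  by rewrite -[x](mulKg s0) -s0x mulVg X1.
have x1G : s0 * x \in G.
  by apply: groupM; [apply: (subsetP SG) | apply: (subsetP (XG M))].
apply/negPn/negP => xN.
have key s : s \in S -> s^-1 * (s0 * x) \notin X N.
  move=> sS; apply: contra xN => sx; have ss : s0 = s.
    apply: sepS => //.
    have -> : s0^-1 * s = x * (s^-1 * (s0 * x))^-1.
      by rewrite !invMg invgK -mulgA mulKVg.
    by apply: XM => //; apply: XV.
  by move: sx; rewrite ss mulKg.
suff /(@leq_bigmax_cond _ (separated N) (fun S => #|pred_of_set S|)) :
    separated N (s0 * x |: S).
  by rewrite -/(sepnum N) e cardS cardsU1 xS ltnn.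
apply/separatedP; split=> [|s t]; first by rewrite subUset sub1set x1G.
case/setU1P=> [->|sS] /setU1P[->|tS] // st.
- case/negP: (key t tS); rewrite -[X in X \in _]invgK; apply: XV.
  by rewrite invMg invgK.
- by case/negP: (key s sS).
- by apply: sepS => //; apply: (subsetP (Xle leN)).
Qed.

(** Taking [M = N * N] in [sepnum_stable], products of elements of [X N] fall back into [X N]. *)
Lemma sepnum_stable_group_set N :
  0 < N -> sepnum N = sepnum (N * N * N) -> group_set (X N).
Proof.
move=> N0 e; have XN : X (N * N) = X N.
  by apply: sepnum_stable => //; rewrite leq_pmulr.
by apply/group_setP; split=> [|x y xX yX]; rewrite ?X1 // -XN XM.
Qed.
End Filtration.

(** * Bihomomorphisms and their probability of vanishing *)

Definition bihom (aT bT cT : finGroupType) (phi : aT -> bT -> cT) :=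
  (forall b, {morph phi^~ b : x y / x * y}) /\
  (forall a, {morph phi a : x y / x * y}).

(** Relative to subsets of fixed types, so that both groups can shrink while [phi] is kept. *)
Definition pr (R : realFieldType) (aT bT cT : finGroupType)
    (phi : aT -> bT -> cT) (G : {set aT}) (H : {set bT}) : R :=
  (#|[set ab in setX G H | phi ab.1 ab.2 == 1%g]|%:R / (#|G|%:R * #|H|%:R))%R.

Lemma bihom_flip (aT bT cT : finGroupType) (phi : aT -> bT -> cT) :
  bihom phi -> bihom (fun b => phi^~ b).
Proof. by case. Qed.

Lemma pr_flip (R : realFieldType) (aT bT cT : finGroupType)
    (phi : aT -> bT -> cT) (G : {set aT}) (H : {set bT}) :
  pr R phi G H = pr R (fun b => phi^~ b) H G.
Proof.
rewrite /pr [(#|G|%:R * _)%R]mulrC; congr (_%:R / _)%R.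
have inj : injective (fun p : aT * bT => (p.2, p.1)) by move=> [? ?] [? ?] [-> ->].
rewrite -(card_imset _ inj); congr #|pred_of_set _|; apply/setP=> -[b a].
apply/imsetP/idP => [[[a' b'] + [-> ->]]|]; rewrite !inE /=.
  by rewrite andbC [X in _ && X]andbC andbC.
by rewrite [X in X && _]andbC => h; exists (a, b); rewrite ?inE.
Qed.

Section Bihom.
Variables (aT bT cT : finGroupType) (phi : aT -> bT -> cT).
Hypothesis phiM : bihom phi.
Implicit Types (G : {group aT}) (H : {group bT}).

Lemma phi1l b : phi 1 b = 1.
Proof. by apply: (mulgI (phi 1 b)); rewrite -phiM.1 !mulg1. Qed.

Lemma phi1r a : phi a 1 = 1.
Proof. by apply: (mulgI (phi a 1)); rewrite -phiM.2 !mulg1. Qed.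

Lemma phiVl a b : phi a^-1 b = (phi a b)^-1.
Proof. by apply: (mulgI (phi a b)); rewrite -phiM.1 !mulgV phi1l. Qed.

Lemma phiVr a b : phi a b^-1 = (phi a b)^-1.
Proof. by apply: (mulgI (phi a b)); rewrite -phiM.2 !mulgV phi1r. Qed.

Lemma group_set_phi a H : group_set (phi a @: H).
Proof.
apply/group_setP; split; first by apply/imsetP; exists 1; rewrite ?phi1r.
move=> _ _ /imsetP[x xH ->] /imsetP[y yH ->]; rewrite -phiM.2.
by apply: imset_f; apply: groupM.
Qed.
Canonical phi_group a H := Group (group_set_phi a H).

Lemma card_phi_ker a H :
  (#|phi a @: H| * #|[set b in H | phi a b == 1%g]| = #|H|)%N.
Proof.
pose f := Morphism (D := setT) (in2W (phiM.2 a)).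
have := card_morphim f H; rewrite morphimEsub ?subsetT // => ->.
rewrite setTI; set K := [set _ in _ | _].
suff -> : K = H :&: 'ker f by rewrite -indexgI mulnC Lagrange ?subsetIl.
by apply/setP=> b; rewrite !inE.
Qed.

(** For fixed a, the zeros in H form a kernel, of density 1/|phi(a, H)| by the first isomorphism
    theorem. *)
Lemma prE (R : realFieldType) G H :
  pr R phi G H = ((\sum_(a in G) #|phi a @: H|%:R^-1) / #|G|%:R)%R.
Proof.
have card_neq0 (gT : finGroupType) (K : {group gT}) : (#|K|%:R != 0 :> R)%R.
  by rewrite pnatr_eq0 -lt0n cardG_gt0.
rewrite /pr; have -> : #|[set ab in setX G H | phi ab.1 ab.2 == 1]| =
          (\sum_(a in G) #|[set b in H | phi a b == 1%g]|)%N.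
  rewrite -sum1_card; under [RHS]eq_bigr do rewrite -sum1_card.
  rewrite pair_big_dep /=; apply: eq_bigl => -[a b].
  by rewrite !inE /= andbA.
rewrite natr_sum invfM mulrA [LHS]mulrAC mulr_suml; congr (_ / _)%R.
apply: eq_bigr => a _; apply: (mulIf (card_neq0 _ H)).
rewrite mulfVK ?card_neq0 // -(card_phi_ker a H) natrM mulKf //.
exact: (card_neq0 _ (phi_group a H)).
Qed.


(** * Balls for the submultiplicative length |phi(a, H)| on G *)

Definition narrow G H N := [set a in G | #|phi a @: H| <= N].

Lemma narrow_sub G H N : narrow G H N \subset G.
Proof. by apply/subsetP => x; rewrite inE => /andP[]. Qed.

Lemma narrow_le G H M N : M <= N -> narrow G H M \subset narrow G H N.
Proof.
move=> MN; apply/subsetP => x; rewrite !inE => /andP[-> /=].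
by move/leq_trans; apply.
Qed.

Lemma narrow1 G H N : 0 < N -> 1 \in narrow G H N.
Proof.
move=> N0; rewrite inE group1; apply: leq_trans N0; rewrite -(cards1 (1 : cT)).
by apply/subset_leq_card/subsetP => _ /imsetP[b _ ->]; rewrite phi1l inE.
Qed.

Lemma narrowV G H N x : x \in narrow G H N -> x^-1 \in narrow G H N.
Proof.
rewrite !inE groupV => /andP[-> le]; apply: leq_trans le.
rewrite -[leqRHS](card_imset _ invg_inj) subset_leq_card //.
apply/subsetP=> _ /imsetP[b bH ->]; rewrite phiVl.
by rewrite !imset_f.
Qed.

Lemma narrowM G H M N x y :
  x \in narrow G H M -> y \in narrow G H N -> x * y \in narrow G H (M * N)%N.
Proof.
rewrite !inE => /andP[xG xM] /andP[yG yN]; rewrite groupM //=.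
apply: leq_trans (leq_mul xM yN).
apply: (@leq_trans #|(phi x @: H) * (phi y @: H)|).
  apply/subset_leq_card/subsetP=> _ /imsetP[b bH ->]; rewrite phiM.1.
  by apply: mem_mulg; apply: imset_f.
by rewrite (mul_cardG (phi_group x H) (phi_group y H)) leq_pmulr ?cardG_gt0.
Qed.

Definition narrow_sepnum_card G H :=
  sepnum_card (@narrow_sub G H) (@narrowV G H) (@narrowM G H).

Definition narrow_sepnum_stable G H :=
  sepnum_stable (@narrow_sub G H) (@narrow1 G H) (@narrowV G H)
    (@narrow_le G H) (@narrowM G H).

Definition narrow_group_set G H :=
  sepnum_stable_group_set (@narrow_sub G H) (@narrow1 G H) (@narrowV G H)
    (@narrow_le G H) (@narrowM G H).

(** In the average [prE], elements of the ball contribute at most 1, the others at most 1/(N +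
    1). *)
Lemma pr_le_narrow (R : realFieldType) G H N :
  (pr R phi G H <= #|narrow G H N|%:R / #|G|%:R + N.+1%:R^-1)%R.
Proof.
have G0 : (0 < #|G|%:R :> R)%R by rewrite ltr0n cardG_gt0.
rewrite prE ler_pdivrMr // mulrDl divfK ?gt_eqF //.
rewrite (bigID (mem (narrow G H N))) /=; apply: lerD.
  rewrite -sum1_card natr_sum [leLHS](eq_bigl (mem (narrow G H N))).
    apply: ler_sum => a _; rewrite invf_le1 ?ler1n ?ltr0n;
    exact: (cardG_gt0 (phi_group a H)).
  by move=> a; rewrite /= inE; case: (a \in G).
apply: (@le_trans _ _ (\sum_(a in G) N.+1%:R^-1)%R).
  rewrite [leRHS](bigID (mem (narrow G H N))) /= ler_wpDl //.
    by apply: sumr_ge0 => a _; rewrite invr_ge0 ler0n.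
  apply: ler_sum => a /andP[aG]; rewrite !inE aG /= -ltnNge => lt.
  by rewrite lef_pV2 ?ler_nat // posrE ltr0n //; apply: leq_trans lt.
by rewrite sumr_const -[(_ *+ _)%R]mulr_natr.
Qed.

(** In the average over G, the terms in K give the main term and the others add at most 1/(N +
    1). *)
Lemma pr_subgroup (R : realFieldType) G (K : {group aT}) H N :
    K \subset G -> (forall a, a \in G :\: K -> N < #|phi a @: H|) ->
  (pr R phi K H * #|G : K|%:R^-1 <= pr R phi G H
     <= pr R phi K H * #|G : K|%:R^-1 + N.+1%:R^-1)%R.
Proof.
move=> KG wide.
have K0 : (0 < #|K|%:R :> R)%R by rewrite ltr0n cardG_gt0.
have G0 : (0 < #|G|%:R :> R)%R by rewrite ltr0n cardG_gt0.
set s := (\sum_(a in G :\: K) #|phi a @: H|%:R^-1 : R)%R.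
have -> : pr R phi G H = (pr R phi K H * #|G : K|%:R^-1 + s / #|G|%:R)%R.
  rewrite !prE -mulrA -invfM -natrM Lagrange // -mulrDl; congr (_ / _)%R.
  by rewrite (big_setID K) /= (setIidPr KG).
have s0 : (0 <= s)%R by apply: sumr_ge0 => a _; rewrite invr_ge0 ler0n.
rewrite lerDl lerD2l divr_ge0 ?ler0n //= ler_pdivrMr //.
apply: (@le_trans _ _ (\sum_(a in G :\: K) N.+1%:R^-1)%R).
  apply: ler_sum => a /wide lt.
  by rewrite lef_pV2 ?ler_nat // posrE ltr0n //; apply: leq_trans lt.
rewrite sumr_const -[(_ *+ _)%R]mulr_natr ler_wpM2l ?invr_ge0 ?ler0n //.
by rewrite ler_nat subset_leq_card ?subsetDl.
Qed.

(* If phi a0 H is of maximal size, then an element x of G killed by a set of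
   preimages of phi a0 H satisfies phi x H \subset phi a0 H, since
   phi (a0 * x) H contains phi a0 H.  So the elements of G fall into at most
   N ^ N classes modulo those with image in phi a0 H. *)
Lemma card_phi_span G H N :
    abelian [set: cT] -> (forall a, a \in G -> #|phi a @: H| <= N) ->
    (forall b, b \in H -> #|phi^~ b @: G| <= N) ->
  #|<<phi @2: (G, H)>>| <= N ^ (N ^ N).+1.
Proof.
move=> cTab wG wH.
have N0 : 0 < N by apply: leq_trans (wG 1 _) => //; apply: (cardG_gt0 (phi_group 1 H)).
have [a0 a0G a0max] : exists2 a0, a0 \in G &
    forall a, a \in G -> #|phi a @: H| <= #|phi a0 @: H|.
  by have [a0 a0G a0max] := arg_maxnP (fun a => #|phi a @: H|) (group1 G); exists a0.
pose E := phi_group a0 H.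
(* A chosen preimage of [e] under [phi a0]; the default 1 serves only outside [E]. *)
pose b e := odflt 1 [pick b in H | phi a0 b == e].
have bH e : b e \in H.
  by rewrite /b; case: pickP => [x /andP[]|] //= _; apply: group1.
have bE e : e \in E -> phi a0 (b e) = e.
  move=> /imsetP[x xH ->]; rewrite /b; case: pickP => [y /andP[_ /eqP]|] //=.
  by move/(_ x); rewrite xH eqxx.
(* [f g] records [phi g] at the chosen preimages: at most N points, with at most N values at
   each. *)
pose f g := [ffun e : cT => if e \in E then phi g (b e) else 1].
have card_f : #|f @: G| <= N ^ N.
  pose F e : {set cT} := if e \in E then phi^~ (b e) @: G else [set 1].
  apply: (@leq_trans #|family F|).
    apply/subset_leq_card/subsetP => _ /imsetP[g gG ->].
    by apply/familyP => e; rewrite ffunE /F; case: ifP => _; rewrite ?inE // imset_f.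
  rewrite card_family foldrE big_map big_enum /= (bigID (mem E)) /=.
  rewrite [X in (_ * X)%N]big1 ?muln1; last first.
    by move=> e /negPf; rewrite /F => ->; rewrite cards1.
  apply: (@leq_trans (N ^ #|E|)); last by rewrite leq_pexp2l // wG.
  rewrite -prod_nat_const; apply: leq_prod => e eE.
  by rewrite /F eE; apply: wH.
have f_eq g g' : g \in G -> g' \in G -> f g = f g' ->
    {in H, forall h, phi (g^-1 * g') h \in E}.
  move=> gG g'G fgg'; set x := g^-1 * g'.
  have xG : x \in G by rewrite groupM ?groupV.
  have xb e : e \in E -> phi x (b e) = 1.
    move=> eE; have := congr1 (fun F : {ffun cT -> cT} => F e) fgg'.
    by rewrite !ffunE eE phiM.1 phiVl => ->; rewrite mulVg.
  have EE : E :=: phi_group (a0 * x) H.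
    apply/eqP; rewrite eqEcard; apply/andP; split; last by apply: a0max; apply: groupM.
    apply/subsetP => e eE; apply/imsetP; exists (b e) => //.
    by rewrite phiM.1 xb // mulg1 bE.
  move=> h hH; rewrite -(groupMl _ (imset_f (phi a0) hH : _ \in E)) -phiM.1.
  by rewrite EE imset_f.
pose r v := odflt 1 [pick g in G | f g == v].
have rG v : r v \in G.
  by rewrite /r; case: pickP => [x /andP[]|] //= _; apply: group1.
have rE g : g \in G -> f (r (f g)) = f g.
  move=> gG; rewrite /r; case: pickP => [y /andP[_ /eqP]|] //=.
  by move/(_ g); rewrite gG eqxx.
pose fG := f @: G.
(* At most N ^ N + 1 subgroups of order at most N generate [D]: one per value of [f], and [E]. *)
pose D := (\prod_(v in fG) phi_group (r v) H * E)%G.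
apply: (@leq_trans #|D|).
  apply: subset_leq_card; rewrite gen_subG; apply/subsetP.
  move=> _ /imset2P[g h gG hH ->].
  rewrite -[g](mulKVg (r (f g))) phiM.1 groupM //.
    apply: (subsetP (joing_subl _ _)); rewrite bigprodGE mem_gen //.
    by apply/bigcupP; exists (f g); rewrite imset_f.
  by apply: (subsetP (joing_subr _ _)); apply: f_eq => //; apply: rE.
have card_join (A B : {group cT}) : #|A <*> B| <= #|A| * #|B|.
  rewrite cent_joinEl ?mul_cardG ?leq_pmulr ?cardG_gt0 //.
  exact: sub_abelian_cent2 cTab (subsetT _) (subsetT _).
apply: leq_trans (card_join _ _) _.
apply: (@leq_trans (N ^ #|f @: G| * N)).
  rewrite leq_mul ?wG //= -prod_nat_const.
  apply: (big_ind2 (fun (A : {group cT}) n => #|A| <= n)) => [|A m B n|v _].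
  - by rewrite cards1.
  - by move=> Am Bn; apply: leq_trans (card_join _ _) (leq_mul Am Bn).
  - exact: wG.
by rewrite expnSr leq_mul // leq_pexp2l.
Qed.

End Bihom.

(** * Averaging over characters of an abelian group *)

(** Characters of D trivial on E are those of the abelian group D/E, which has as many as
    elements. *)
Lemma card_irr_cfker (gT : finGroupType) (D E : {group gT}) :
    abelian D -> E \subset D ->
  #|[set i : Iirr D | E \subset cfker ('chi_i)%R]| = #|D : E|.
Proof.
move=> abD ED; have nED : normal E D by rewrite -sub_abelian_normal.
have := on_card_preimset (R := [set i | E \subset cfker ('chi_i)%R])
  (f := mod_Iirr (H := E)).
move=> <-; last first.
  have [g gK Kg] := mod_Iirr_bij nED.
  by exists g => i; rewrite inE => Ei; [apply: gK | apply: Kg].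
rewrite -card_quotient ?normal_norm // -card_Iirr_abelian ?quotient_abelian //.
apply: eq_card => i; rewrite !inE mod_IirrE //.
by rewrite cfker_mod.
Qed.

(* 1/|E| is |D|^-1 times the number of characters of D that are trivial on E,
   here with E = phi(G, b). *)
Lemma pr_irr (R : realFieldType) (aT bT cT : finGroupType) (phi : aT -> bT -> cT)
    (G : {group aT}) (H : {group bT}) (D : {group cT}) :
    bihom phi -> abelian D -> {in G & H, forall a b, phi a b \in D} ->
  exists m : nat -> nat,
    pr R phi G H = (#|D|%:R^-1 * \sum_(j < #|D|) (m j)%:R^-1)%R.
Proof.
move=> phiM abD phiD.
pose E := phi_group (bihom_flip phiM).
have ED b : b \in H -> E b G \subset D.
  by move=> bH; apply/subsetP=> _ /imsetP[a aG ->]; apply: phiD.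
(* Once the sums over b and over characters are exchanged, the i-th character contributes |K i|/|H|
   = 1/|H : K i|. *)
pose K (i : Iirr D) := [set b in H | E b G \subset cfker ('chi_i)%R].
have groupK i : group_set (K i).
  apply/group_setP; split=> [|x y].
    rewrite !inE group1; apply/subsetP=> _ /imsetP[a aG ->].
    by rewrite (phi1r phiM) group1.
  rewrite !inE => /andP[xH /subsetP xK] /andP[yH /subsetP yK]; rewrite groupM //=.
  apply/subsetP => _ /imsetP[a aG ->]; rewrite phiM.2.
  by apply: groupM; [apply: xK | apply: yK]; apply: imset_f.
(* Indexing by naturals instead of [Iirr D] keeps the sum uniform when [D] varies in a family. *)
exists (fun j => #|H : K (inord j)|).
have eN : Nirr D = #|D| by rewrite NirrE; apply/eqP; rewrite -card_classes_abelian.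
have H0 : (#|H|%:R != 0 :> R)%R by rewrite pnatr_eq0 -lt0n cardG_gt0.
have D0 : (#|D|%:R != 0 :> R)%R by rewrite pnatr_eq0 -lt0n cardG_gt0.
rewrite -[in X in (_ * X)%R]eN pr_flip (prE (bihom_flip phiM)).
have idxK i : (#|H : K i|%:R^-1 = #|K i|%:R / #|H|%:R :> R)%R.
  have KH : K i \subset H by apply/subsetP => b; rewrite inE => /andP[].
  rewrite -(@Lagrange _ H (Group (groupK i)) KH) natrM invfM mulrA divff ?mul1r //.
  by rewrite pnatr_eq0 -lt0n (cardG_gt0 (Group (groupK i))).
under [in RHS]eq_bigr do rewrite inord_val idxK.
rewrite -mulr_suml mulrA; congr (_ / _)%R.
have cardK i : (#|K i|%:R = \sum_(b in H) (E b G \subset cfker ('chi_i)%R)%:R :> R)%R.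
  rewrite -sum1_card natr_sum big_mkcond [RHS]big_mkcond; apply: eq_bigr => b _.
  by rewrite inE; case: (b \in H); case: (_ \subset _).
under [in RHS]eq_bigr do rewrite cardK.
rewrite exchange_big mulr_sumr; apply: eq_bigr => b bH.
rewrite -natr_sum -big_mkcond sum1_card.
have := card_irr_cfker abD (ED b bH); rewrite cardsE => ->.
apply: (mulfI D0); rewrite mulVKf // -(Lagrange (ED b bH)) natrM mulrC mulKf //.
by rewrite pnatr_eq0 -lt0n (cardG_gt0 (E b G)).
Qed.

End FiniteGroups.

Local Open Scope classical_set_scope.
Local Open Scope ring_scope.

(** * Rational limits approached from above along an ultrafilter *)

Definition rational_limit_above (R : realType) (I : Type) (F : set_system I)
    (u : I -> R) :=
  exists2 q : rat, u @ F --> (ratr q : R) & \forall i \near F, ratr q <= u i.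

Section RationalLimitAbove.
Variables (R : realType) (I : Type) (F : set_system I).
Hypothesis FU : UltraFilter F.
Implicit Types u v : I -> R.
Local Notation ratlim := (@rational_limit_above R I F).

Let FP : ProperFilter F. Proof. exact: ultra_proper. Qed.

Lemma ultra_dec (P : set I) : ~ F P -> F (~` P).
Proof. by case: (in_ultra_setVsetC P FU). Qed.

Lemma ratlim_cst (q : rat) : ratlim (fun=> ratr q).
Proof. by exists q; [apply: cvg_cst | apply: nearW]. Qed.

Lemma ratlim_near u v : (\forall i \near F, u i = v i) -> ratlim u -> ratlim v.
Proof.
move=> uv [q uq qu]; exists q.
  by apply: cvg_trans uq; apply: near_eq_cvg; apply: filterS uv => i ->.
by apply: filterS2 uv qu => i ->.
Qed.

Lemma ratlimD u v : ratlim u -> ratlim v -> ratlim (fun i => u i + v i).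
Proof.
move=> [p up pu] [q vq qv]; exists (p + q); rewrite rmorphD /=.
  exact: cvgD.
by apply: filterS2 pu qv => i; apply: lerD.
Qed.

Lemma ratlimM u v : (forall i, 0 <= u i) -> (forall i, 0 <= v i) ->
  ratlim u -> ratlim v -> ratlim (fun i => u i * v i).
Proof.
move=> u0 v0 [p up pu] [q vq qv].
have p0 : 0 <= ratr p :> R by apply: (cvgr_to_ge up); apply: nearW.
have q0 : 0 <= ratr q :> R by apply: (cvgr_to_ge vq); apply: nearW.
exists (p * q); rewrite rmorphM /=; first exact: cvgM.
by apply: filterS2 pu qv => i pi qi; apply: ler_pM.
Qed.

Lemma ratlim_sum (n : nat) (u : nat -> I -> R) :
  (forall j, ratlim (u j)) -> ratlim (fun i => \sum_(j < n) u j i).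
Proof.
move=> gu; elim: n => [|n IHn].
  apply: ratlim_near (ratlim_cst 0).
  by apply: nearW => i; rewrite big_ord0 rmorph0.
apply: ratlim_near (ratlimD IHn (gu n)).
by apply: nearW => i; rewrite big_ord_recr.
Qed.

Lemma ratlim_squeeze u v :
    (forall N, \forall i \near F, u i <= v i <= u i + N.+1%:R^-1) ->
  ratlim u -> ratlim v.
Proof.
move=> uv [q uq qu]; exists q; last first.
  by apply: filterS2 (uv 0%N) qu => i /andP[uvi _]; move/le_trans; apply.
have vu0 : (fun i => v i - u i) @ F --> (0 : R).
  apply/cvgrPdist_le => e e0.
  have [N _ eN] := near_infty_natSinv_lt (PosNum e0).
  apply: filterS (uv N) => i /andP[le1 le2].
  rewrite sub0r normrN ger0_norm ?subr_ge0 // lerBlDl (le_trans le2) // lerD2l ltW //.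
  exact: (eN N (leqnn N)).
have -> : v = u + (fun i => v i - u i) by apply/funext => i; rewrite fctE subrKC.
by rewrite -[ratr q]addr0; apply: cvgD.
Qed.

Lemma ratlim_small u :
  (forall N, \forall i \near F, 0 <= u i <= N.+1%:R^-1) -> ratlim u.
Proof.
move=> u0; apply: ratlim_squeeze (ratlim_cst 0) => N.
by apply: filterS (u0 N) => i; rewrite rmorph0 add0r.
Qed.

(** An ultrafilter selects one of finitely many values. *)
Lemma ultra_bounded_nat (f : I -> nat) M :
  (\forall i \near F, (f i <= M)%N) -> exists c, \forall i \near F, f i = c.
Proof.
elim: M => [|M IHM] fM.
  by exists 0%N; apply: filterS fM => i; rewrite leqn0 => /eqP.
have [fM1|/ultra_dec fM1] := pselect (\forall i \near F, f i = M.+1).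
  by exists M.+1.
apply: IHM; apply: filterS2 fM fM1 => i.
by rewrite leq_eqVlt => /orP[/eqP|].
Qed.

(** Either m is F-almost everywhere bounded, hence constant, or it eventually exceeds every N and
    1/m tends to 0. *)
Lemma ratlim_invn (m : I -> nat) : ratlim (fun i => (m i)%:R^-1).
Proof.
have [[M mM]|/forallNP unb] :=
    pselect (exists M, \forall i \near F, (m i <= M)%N).
  have [c mc] := ultra_bounded_nat mM.
  apply: ratlim_near (ratlim_cst (c%:R^-1)).
  by apply: filterS mc => i ->; rewrite fmorphV /= ratr_nat.
apply: ratlim_small => N; apply: filterS (ultra_dec (unb N)) => i /negP.
rewrite -ltnNge => lt; rewrite invr_ge0 ler0n /=.
by rewrite lef_pV2 ?ler_nat // posrE ltr0n //; apply: leq_trans lt.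
Qed.

End RationalLimitAbove.

(** * Reduction of families of maps to bounded images *)

Section Families.
Variables (R : realType) (I : Type) (F : set_system I).
Hypothesis FU : UltraFilter F.
Local Notation ratlim := (@rational_limit_above R I F).

Let FP : ProperFilter F. Proof. exact: ultra_proper. Qed.

Lemma pr_ge0 (aT bT cT : finGroupType) (phi : aT -> bT -> cT) G H :
  0 <= pr R phi G H.
Proof. by rewrite divr_ge0 ?mulr_ge0 ?ler0n. Qed.

Section NarrowSubgroup.
Variables (aT bT cT : I -> finGroupType) (phi : forall i, aT i -> bT i -> cT i).
Arguments phi : clear implicits.
Variables (G : forall i, {group aT i}) (H : forall i, {group bT i}).
Hypothesis phiM : forall i, bihom (phi i).

Let X N i := narrow (phi i) (G i) (H i) N.
Let s N i := sepnum (G i) (narrow (phi i) (G i) (H i)) N.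

Lemma sepnum_bounded (e : nat) :
  (\forall i \near F, e.+1%:R^-1 < pr R (phi i) (G i) (H i)) ->
  exists C N, (0 < N)%N /\ \forall i \near F, (s N i <= C)%N.
Proof.
(* As 1/(e + 1) = 2/d, the ball of radius d has density above 1/d, which leaves room for at most d
   disjoint translates. *)
move=> pre; set d := (2 * e.+1)%N.
exists d, (d * d)%N; split; first by rewrite muln_gt0.
apply: filterS pre => i pri.
have : e.+1%:R^-1 < #|X d i|%:R / #|G i|%:R + d%:R^-1 :> R.
  apply: (lt_le_trans pri); apply: le_trans (pr_le_narrow (phiM i) R _ _ d.-1) _.
  rewrite prednK ?muln_gt0 // lerD2r ler_pM2r ?invr_gt0 ?ltr0n ?cardG_gt0 //.
  by rewrite ler_nat subset_leq_card // narrow_le ?leq_pred.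
have -> : e.+1%:R^-1 = d%:R^-1 + d%:R^-1 :> R.
  by rewrite /d natrM invfM -mulrDl -[in RHS](mulr1 2^-1) -mulrDr -[1 + 1]/2%:R
    mulVf ?mul1r.
rewrite ltrD2r ltr_pdivlMr ?ltr0n ?cardG_gt0 // mulrC ltr_pdivrMr ?ltr0n ?muln_gt0 //.
rewrite -natrM ltr_nat => lt.
have X0 : (0 < #|X d i|)%N by case: #|X d i| lt => //; rewrite mul0n.
rewrite -(leq_pmul2r X0) [leqRHS]mulnC; apply: leq_trans (ltnW lt).
exact: narrow_sepnum_card.
Qed.

(** For large N the packing number is F-almost everywhere constant; these constants decrease with N,
    so they stabilise. *)
Lemma narrow_stable (e : nat) :
    (\forall i \near F, e.+1%:R^-1 < pr R (phi i) (G i) (H i)) ->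
  exists N, (\forall i \near F, group_set (X N i)) /\
    forall M, \forall i \near F, (X M i \subset X N i)%SET.
Proof.
move=> /sepnum_bounded[C [N1 [N10 sN1]]].
have s_le i M N : (M <= N)%N -> (s N i <= s M i)%N.
  by move=> MN; apply: sepnum_le => // ? ?; apply: narrow_le.
have s_cst N : (N1 <= N)%N -> exists c, \forall i \near F, s N i = c.
  move=> le; apply: (@ultra_bounded_nat _ F FU (s N) C).
  by apply: filterS sN1 => i; apply: leq_trans; apply: s_le.
(* N is chosen to minimize the F-almost everywhere constant value of s N. *)
have [c0 /asboolP[N [le sN]] cmin] :
    exists2 c, `[< exists N, (N1 <= N)%N /\ \forall i \near F, s N i = c >]
      & forall c', `[< exists N, (N1 <= N)%N /\ \forall i \near F, s N i = c' >] ->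
          (c <= c')%N.
  have ex : exists c, `[< exists N, (N1 <= N)%N /\ \forall i \near F, s N i = c >].
    have [c sc] := s_cst _ (leqnn N1).
    by exists c; apply/asboolP; exists N1.
  by case: (ex_minnP ex) => c P Pmin; exists c.
have N0 : (0 < N)%N by apply: leq_trans le.
have sM M : (N <= M)%N -> \forall i \near F, s N i = s M i.
  move=> NM; have leM := leq_trans le NM.
  have [c sc] := s_cst _ leM.
  have c0c : (c0 <= c)%N by apply: cmin; apply/asboolP; exists M.
  apply: filterS2 sN sc => i sNi sci; apply/eqP; rewrite eqn_leq (s_le _ _ _ NM) andbT.
  by rewrite sNi sci.
exists N; split=> [|M].
  have : (N <= N * N * N)%N by rewrite leq_pmull // muln_gt0 N0.
  move/sM; apply: filterS => i sNi; exact: narrow_group_set sNi.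
have [MN|/ltnW NM] := leqP M N; first by apply: nearW => i; apply: narrow_le.
have : (N <= M * N)%N by rewrite leq_pmull // (leq_trans N0).
move/sM; apply: filterS => i sNi.
by rewrite /X (narrow_sepnum_stable (phiM i) N0 NM sNi).
Qed.

Lemma narrow_reduction :
  ratlim (fun i => pr R (phi i) (G i) (H i)) \/
  exists N (K : forall i, {group aT i}),
    [/\ forall i, K i \subset G i,
        \forall i \near F, forall a, a \in K i -> (#|phi i a @: H i| <= N)%N
      & ratlim (fun i => pr R (phi i) (K i) (H i)) ->
        ratlim (fun i => pr R (phi i) (G i) (H i))].
Proof.
have [small|/existsNP[e /(ultra_dec FU) large]] := pselect (forall e,
    \forall i \near F, pr R (phi i) (G i) (H i) <= e.+1%:R^-1).
  left; apply: (ratlim_small FU) => e; apply: filterS (small e) => i ->.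
  by rewrite pr_ge0.
right; have [|N [grp stab]] := @narrow_stable e.
  by apply: filterS large => i /negP; rewrite -ltNge.
(* The generated group makes sense for every i and equals [X N i] F-almost everywhere. *)
exists N, (fun i => <<X N i>>%G); split.
- by move=> i; rewrite gen_subG narrow_sub.
- apply: filterS grp => i grpX a; rewrite (genGidG (Group grpX)) => aX.
  by move: aX; rewrite inE => /andP[].
move=> gK.
have gi := ratlim_invn R FU (fun i => #|G i : <<X N i>>|%g).
apply: (ratlim_squeeze FU _ (ratlimM FU _ _ gK gi)) => [M|i|i] //; last first.
  exact: pr_ge0.
apply: filterS2 grp (stab M) => i grpX XM.
apply: (pr_subgroup (phiM i)); first by rewrite gen_subG narrow_sub.
move=> a; rewrite (genGidG (Group grpX)) => /setDP[aG]; rewrite ltnNge.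
by apply: contra => aM; apply: (fintype.subsetP XM); rewrite inE aG.
Qed.

End NarrowSubgroup.

Lemma ratlim_pr (aT bT cT : I -> finGroupType)
    (phi : forall i, aT i -> bT i -> cT i)
    (G : forall i, {group aT i}) (H : forall i, {group bT i}) :
    (forall i, bihom (phi i)) -> (forall i, abelian [set: cT i]%SET) ->
  ratlim (fun i => pr R (phi i) (G i) (H i)).
Proof.
move=> phiM cab.
have [//|[N [K [_ wK]]]] := narrow_reduction G H phiM; apply.
under eq_fun do rewrite pr_flip.
have [//|[M [L [LH wL]]]] := narrow_reduction H K (fun i => bihom_flip (phiM i)); apply.
under eq_fun do rewrite -pr_flip.
pose D i := <<phi i @2: (K i, L i)>>%G.
set B := maxn N M.
have DB : \forall i \near F, (#|D i| <= B ^ (B ^ B).+1)%N.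
  apply: filterS2 wK wL => i wKi wLi.
  apply: card_phi_span => //= [a aK|b bL]; last first.
    exact: leq_trans (wLi b bL) (leq_maxr _ _).
  apply: leq_trans (leq_trans (wKi a aK) (leq_maxl _ _)).
  (* The bound from the first reduction survives the second, since L lies in H. *)
  by apply: subset_leq_card; apply: finset.imsetS; apply: LH.
(* A constant order of [D] fixes the number of unit fractions. *)
have [c Dc] := ultra_bounded_nat FU DB.
have /choice[m prm] : forall i, exists m : nat -> nat,
    pr R (phi i) (K i) (L i) = #|D i|%:R^-1 * \sum_(j < #|D i|) (m j)%:R^-1.
  move=> i; apply: pr_irr => //; first exact: abelianS (finset.subsetT _) (cab i).
  by move=> a b aK bL; apply/mem_gen/imset2_f.
have inv_ge0 n : 0 <= n%:R^-1 :> R by rewrite invr_ge0 ler0n.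
have g : ratlim (fun i => c%:R^-1 * \sum_(j < c) (m i j)%:R^-1).
  apply: (ratlimM FU) => [//|i||]; first by apply: sumr_ge0.
    exact: (ratlim_invn R FU (fun=> c)).
  exact: (ratlim_sum FU c (fun j => ratlim_invn R FU (m ^~ j))).
apply: (ratlim_near FU _ g).
by apply: filterS Dc => i Di; rewrite prm Di.
Qed.

End Families.

(** * Closure and suprema of sets of probabilities *)

Record biadditive_map := BiadditiveMap {
  bl : finZmodType; br : finZmodType; bo : finZmodType;
  bmap : bl -> br -> bo;
  bmapD : biadditive bmap }.

Definition trivial_biadditive_map : biadditive_map :=
  @BiadditiveMap 'I_1 'I_1 'I_1 (fun _ _ => 0)
    (conj (fun _ _ _ => esym (addr0 0)) (fun _ _ _ => esym (addr0 0))).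

Lemma zero_prob_pr (R : realType) (A B C : finZmodType) (phi : A -> B -> C) :
  zero_prob R phi = pr R phi [set: A]%SET [set: B]%SET.
Proof.
rewrite /zero_prob /pr !cardsT; congr (_%:R / _).
by apply: eq_card => ab; rewrite !inE.
Qed.

Lemma zero_prob_le1 (R : realType) (A B C : finZmodType) (phi : A -> B -> C) :
  zero_prob R phi <= 1.
Proof.
rewrite /zero_prob -natrM -card_prod ler_pdivrMr ?mul1r ?ler_nat ?max_card //.
by rewrite ltr0n; apply/card_gt0P; exists (0, 0).
Qed.

Lemma ultra_bilinear_probs (R : realType) (F : set_system R) :
  UltraFilter F -> F (@bilinear_probs R) -> rational_limit_above F id.
Proof.
move=> FU FP; have FF : ProperFilter F := @ultra_proper _ _ FU.
(* The reals themselves index the family: each probability gets a map realising it, any other real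
   the trivial map. *)
have /choice[f fE] : forall x : R, exists b : biadditive_map,
    @bilinear_probs R x -> x = zero_prob R (@bmap b).
  move=> x; have [[A [B [C [phi [phiD xE]]]]]|nx] := pselect (@bilinear_probs R x).
    by exists (BiadditiveMap phiD).
  by exists trivial_biadditive_map.
(* A finZmodType is also a (multiplicatively written) finGroupType, and [bihom]
   for these groups unfolds to [biadditive]. *)
have := @ratlim_pr R R F FU (fun x => bl (f x)) (fun x => br (f x)) (fun x => bo (f x))
  (fun x => @bmap (f x)) (fun x => [set: bl (f x)]%G) (fun x => [set: br (f x)]%G)
  (fun x => bmapD (f x)) (fun x => FinRing.zmod_abelian _).
apply: ratlim_near => //; apply: filterS FP => x Px /=.
by rewrite [RHS](fE x Px) zero_prob_pr.
Qed.

(** An ultrafilter containing S and converging to x has a rational limit, which must be x, and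
    contains the set of reals at least x. *)
Lemma closure_bilinear_probs (R : realType) (S : set R) (x : R) :
    S `<=` @bilinear_probs R -> closure S x ->
  rational x /\ exists2 y, S y & x <= y.
Proof.
move=> SP Sx.
have WF : ProperFilter (within S (nbhs x)) := within_nbhs_proper Sx.
have [F [FU WSF]] := ultraFilterLemma WF.
have FF : ProperFilter F := @ultra_proper _ _ FU.
have FS : F S by apply: WSF; apply: withinT.
have [q Fq Fle] := ultra_bilinear_probs FU (filterS SP FS).
have qx : ratr q = x.
  apply: (cvg_unique _ Fq) => //; apply: cvg_trans WSF _.
  exact: cvg_within.
split; first by exists q.
have [y [Sy qy]] := filter_ex (filterI FS Fle).
by exists y; rewrite -?qx.
Qed.

Theorem corollary1p5 (R : realType) :
  limit_point (@bilinear_probs R) `<=` @rational R /\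
  well_ordered_by_gt (@bilinear_probs R).
Proof.
split=> [x /subset_limit_point Px|S SP S0].
  by have [] := closure_bilinear_probs (@subset_refl _ (@bilinear_probs R)) Px.
have Sub : has_ubound S.
  exists 1 => _ /SP[A [B [C [phi [_ ->]]]]]; exact: zero_prob_le1.
(* The supremum lies in the closure of S, so some member of S reaches it. *)
have [_ [m Sm supm]] := closure_bilinear_probs SP (closure_sup S0 Sub).
by exists m => // x Sx; apply: le_trans supm; apply: ub_le_sup.
Qed.
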